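(* Let Assumptions A1 and A2 (see context) hold for the control-affine system with exponents $p_1,\dots,p_m\in(0,1)$. Let $r\ge1$ and let $L_i(z,\omega)$, $i=1,\dots,r$, be its averaging terms in the time scale $t$. If $$\lim_{\omega\to\infty}\sum_{i=1}^rL_i(z,\omega)=G(z)<\infty\qquad\text{for all }z\in\mathbb{D}_0,$$ and $$0<\max_i p_i\le p^*<\frac{r}{r+1},$$ then $\dot z=G(z)$ represents a complete averaging asymptote; that is, in the $t$-scale complete averaged system $\dot z=\sum_{i=1}^rL_i(z,\omega)+O(\epsilon^{r+1}\omega)$, with $\epsilon=\omega^{p^*-1}$, the remainder tends to $0$ as $\omega\to\infty$, so that the right-hand side tends to $G(z)$.
   Context: System: $\dot x=b_0(x)+\sum_{i=1}^m\omega^{p_i}b_i(x)u_i(k_i\omega t)$, $x\in\mathbb{R}^n$, $\omega>0$, $k_i\in\mathbb{Q}_{>0}$; for the averaging the drift $b_0$ is dropped (being time independent, it is its own average and may be added back). $\mathbb{D}_0\subset\mathbb{D}$ is compact. Assumption A1: $\mathbb{D}\subset\mathbb{R}^n$ is the domain, and for every compact $\mathbb{D}_0\subset\mathbb{D}$ and $i=0,\dots,m$, $b_i$ and all its partial derivatives of all orders are continuous and bounded on $\mathbb{D}_0$. Assumption A2: for $i=1,\dots,m$, $t\mapsto u_i(k_i\omega t)$ on $[0,\infty)$ is measurable; there are $N_i,M_i\in(0,\infty)$ with $|u_i(k_i\omega t_1)-u_i(k_i\omega t_2)|\le N_i|t_1-t_2|$ for all $t_1,t_2\ge0$ and $\sup_t|u_i(k_i\omega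 t)|\le M_i$; it is $T$-periodic with $\int_0^Tu_i(k_i\omega t)\,dt=0$, where $T=(2\pi/\omega)\mathrm{LCM}(k_1^{-1},\dots,k_m^{-1})$; put $T'=\omega T$. Averaging terms: with $\tau=\omega t$, $\epsilon=\omega^{p^*-1}$, $p^*\in(0,1)$, $\eta_i=\omega^{p_i-p^*}$, the drift-free system is $\frac{dx}{d\tau}=\epsilon f_\tau(x)$, $f_\tau=\sum_i\eta_iu_i(k_i\tau)b_i$. Viewing vector fields as derivations, its flow has the formal series $\mathrm{Id}+\sum_{n\ge1}\int_{0\le\tau_n\le\dots\le\tau_1\le\tau}\epsilon f_{\tau_n}\circ\dots\circ\epsilon f_{\tau_1}\,d\tau_n\cdots d\tau_1$; let $V_\tau^{(i)}$ be the component of its formal logarithm that is homogeneous of degree $i$ in $\epsilon f$ (an iterated integral of Lie brackets). Put $\Lambda_i=\frac1{T'}V^{(i)}_{T'}$ and $L_i=\omega\Lambda_i$. The $r$-order averaged system is $\frac{d\bar x}{d\tau}=\sum_{i=1}^r\Lambda_i(\bar x)$; $r=\infty$ is complete averaging. Since $\epsilon f_\tau=O(\epsilon)$ when $\max_ip_i\le p^*$, complete averaging is represented, for finite $r$ and $T'$, as $\frac{d\bar x}{d\tau}=\sum_{i=1}^r\Lambda_i+O(\epsilon^{r+1})$, i.e. in $t$-scale as $\dot z=\sum_{i=1}^rL_i(z,\omega)+O(\epsilon^{r+1}\omega)$. *)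

(* Defs.v *)
(* The state space R^n is 'rV[R]_n. *)
From mathcomp Require Import all_boot all_order all_algebra.
From mathcomp Require Import all_classical all_reals all_analysis.

Set Implicit Arguments.
Unset Strict Implicit.
Unset Printing Implicit Defensive.

Import Order.TTheory GRing.Theory Num.Theory.
Import numFieldNormedType.Exports.

Local Open Scope classical_set_scope.
Local Open Scope ring_scope.

Section Derivations.
Context {R : realType} {n : nat}.
Local Notation V := 'rV[R]_n.

Definition partial (j : 'I_n) (phi : V -> R) : V -> R :=
  fun x => 'D_(delta_mx 0 j) phi x.

Definition partials (s : seq 'I_n) (phi : V -> R) : V -> R :=
  foldr partial phi s.

Definition coordinate (j : 'I_n) : V -> R := fun x => x 0 j.

(* The vector field X acting on functions as the derivation
   sum_j X_j d/dx_j. *)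
Definition vf_act (X : V -> V) (phi : V -> R) : V -> R :=
  fun x => \sum_(j < n) X x 0 j * partial j phi x.

(* chrono X q tau phi x is the q-fold iterated integral over
   0 <= tau_q <= ... <= tau_1 <= tau of
   (X_(tau_q) o ... o X_(tau_1)) phi x.
   The recursion peels off the outermost variable tau_1, whose derivation
   acts first on phi. *)
Fixpoint chrono (X : R -> V -> V) (q : nat) (tau : R) (phi : V -> R) (x : V)
    : R :=
  match q with
  | 0%N => phi x
  | q'.+1 => \int[lebesgue_measure]_(s in `[0%R, tau])
               chrono X q' s (vf_act (X s) phi) x
  end.

(* Component of degree d in X of the k-th power (for composition of operators)
   of sum_(q >= 1) chrono X q tau. *)
Fixpoint chrono_pow (X : R -> V -> V) (tau : R) (k d : nat) (phi : V -> R)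
    : V -> R :=
  match k with
  | 0%N => fun x => if d == 0%N then phi x else 0
  | k'.+1 => fun x => \sum_(1 <= q < d.+1)
               chrono X q tau (chrono_pow X tau k' (d - q) phi) x
  end.

(* Component of degree d in X of the formal logarithm
   log(Id + S) = sum_(k >= 1) (-1)^(k+1)/k S^k of the flow
   Id + S = Id + sum_(q >= 1) chrono X q tau.  The powers k > d
   have no component of degree d. *)
Definition chrono_log (X : R -> V -> V) (tau : R) (d : nat) (phi : V -> R)
    : V -> R :=
  fun x => \sum_(1 <= k < d.+1)
    (-1) ^+ k.+1 / k%:R * chrono_pow X tau k d phi x.

(* The operator chrono_log X tau d is a derivation; the vector field
   representing it has as components its values on the coordinate functions. *)
Definition log_vf (X : R -> V -> V) (tau : R) (d : nat) : V -> V :=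
  fun x => \row_(j < n) chrono_log X tau d (coordinate j) x.

End Derivations.

Section Averaging.
Context {R : realType} {n m : nat}.
Local Notation V := 'rV[R]_n.

(* b ord0 is the drift b_0, and b (lift ord0 i) is the control vector field
   multiplied by the input u i.  D is open, so that the partial derivatives at
   points of K only depend on the values of b i on D. *)
Definition assumption_A1 (D : set V) (b : 'I_m.+1 -> V -> V) : Prop :=
  forall K : set V, compact K -> K `<=` D ->
  forall (i : 'I_m.+1) (l : 'I_n) (s : seq 'I_n),
    let phi := partials s (coordinate l \o b i) in
    [/\ forall x, K x -> forall j : 'I_n, derivable phi x (delta_mx 0 j),
        {within K, continuous phi}
      & [bounded phi x | x in K]].

(* For fractions in lowest terms,
   LCM(a_i / d_i) = LCM(a_i) / GCD(d_i). *)
Definition rat_lcm (a : 'I_m -> rat) : rat :=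
  (\big[lcmn/1%N]_(i < m) `|numq (a i)|%N)%:R /
  (\big[gcdn/0%N]_(i < m) `|denq (a i)|%N)%:R.

Definition period (k : 'I_m -> rat) (w : R) : R :=
  2 * pi / w * ratr (rat_lcm (fun i => (k i)^-1)).

(* The Lipschitz constants N_i depend on w: a constant valid for all w > 0
   would force the inputs to be constant. *)
Definition assumption_A2 (k : 'I_m -> rat) (u : 'I_m -> R -> R) : Prop :=
  forall (w : R), 0 < w -> forall i : 'I_m,
    let v := fun t : R => u i (ratr (k i) * w * t) in
    let T := period k w in
    [/\ measurable_fun (`[0, +oo[ : set R) v,
        exists2 N : R, 0 < N & forall t1 t2, 0 <= t1 -> 0 <= t2 ->
          `|v t1 - v t2| <= N * `|t1 - t2|,
        exists2 M : R, 0 < M & forall t, 0 <= t -> `|v t| <= M,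
        forall t, 0 <= t -> v (t + T) = v t
      & \int[lebesgue_measure]_(t in `[0%R, T]) v t = 0].

Definition epsilon (pstar w : R) : R := w `^ (pstar - 1).

Definition eta_coef (p : 'I_m -> R) (pstar w : R) (i : 'I_m) : R :=
  w `^ (p i - pstar).

Definition f_field (b : 'I_m.+1 -> V -> V) (u : 'I_m -> R -> R)
    (k : 'I_m -> rat) (p : 'I_m -> R) (pstar w tau : R) : V -> V :=
  fun x => \sum_(i < m)
    (eta_coef p pstar w i * u i (ratr (k i) * tau)) *: b (lift ord0 i) x.

(* Averaging terms: Lambda in the time scale tau = w t (with T' = w T),
   L in the time scale t. *)
Definition Lambda (b : 'I_m.+1 -> V -> V) (u : 'I_m -> R -> R)
    (k : 'I_m -> rat) (p : 'I_m -> R) (pstar : R) (i : nat) (w : R) (z : V)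
    : V :=
  let T' := w * period k w in
  T'^-1 *: log_vf (fun tau x => epsilon pstar w *: f_field b u k p pstar w tau x)
             T' i z.

Definition L (b : 'I_m.+1 -> V -> V) (u : 'I_m -> R -> R)
    (k : 'I_m -> rat) (p : 'I_m -> R) (pstar : R) (i : nat) (w : R) (z : V)
    : V :=
  w *: Lambda b u k p pstar i w z.

Definition averaged_rhs (b : 'I_m.+1 -> V -> V) (u : 'I_m -> R -> R)
    (k : 'I_m -> rat) (p : 'I_m -> R) (pstar : R) (r : nat) (w : R) (z : V)
    : V :=
  \sum_(1 <= i < r.+1) L b u k p pstar i w z.

(* g(w, z) = O(h(w)) as w --> +oo, uniformly for z in A. *)
Definition uniform_bigO (A : set V) (g : R -> V -> V) (h : R -> R) : Prop :=
  exists C : R, \forall w \near +oo,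
    forall z, A z -> `|g w z| <= C * `|h w|.

(* F is, on D0 and in the time scale t, a right-hand side
   sum_(i <= r) L_i + O(epsilon^(r+1) w).  The averaging series with r = oo is
   formal (it need not converge), and complete averaging refers to any F
   having this finite expansion. *)
Definition complete_averaging_rhs (D0 : set V) (b : 'I_m.+1 -> V -> V)
    (u : 'I_m -> R -> R) (k : 'I_m -> rat) (p : 'I_m -> R) (pstar : R)
    (r : nat) (F : R -> V -> V) : Prop :=
  uniform_bigO D0 (fun w z => F w z - averaged_rhs b u k p pstar r w z)
    (fun w => epsilon pstar w ^+ r.+1 * w).

End Averaging.

(* Main.v *)
Require Import Defs.
From mathcomp Require Import all_boot all_order all_algebra.
From mathcomp Require Import all_classical all_reals all_analysis.
From mathcomp Require Import ring lra.

Import Order.TTheory GRing.Theory Num.Theory.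
Import numFieldNormedType.Exports.

Local Open Scope classical_set_scope.
Local Open Scope ring_scope.

(* Write eps f_tau = sum_i alpha_i u_i(k_i tau) b_i with amplitudes
   alpha_i = eps eta_i; for w >= 1 and max p_i <= p*, |alpha_i| <= eps.  Pulling
   the amplitudes and the time integrals of the inputs out of the chronological
   series, the degree d part of the formal logarithm of the flow is a finite
   sum of terms a(alpha) B, with B a fixed differential operator whose
   coefficients are bounded on D0 and |a(alpha)| <= C eps^d.  As w T(w) does not
   depend on w, this gives |L_d| <= C eps^d w uniformly on D0, hence the
   O(eps^(r+1) w) for d > r.  Finally eps^(r+1) w = w^((p* - 1)(r + 1) + 1) has a
   negative exponent exactly when p* < r / (r + 1). *)

(** * Functions differentiable to all orders on an open set with bounds on [D0], and the linear
    operators that preserve them *)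

Section SmoothFunctions.
Context {R : realType} {n : nat} (D D0 : set 'rV[R]_n).
Hypotheses (openD : open D) (subD0 : D0 `<=` D).
Local Notation V := 'rV[R]_n.

(* The derivatives exist on the open set D, but are bounded on D0 only. *)
Fixpoint smooth_upto (k : nat) (phi : V -> R) : Prop :=
  (exists C, forall x, D0 x -> `|phi x| <= C) /\
  match k with
  | 0%N => True
  | k'.+1 => forall j, (forall x, D x -> derivable phi x (delta_mx 0 j)) /\
                       smooth_upto k' (partial j phi)
  end.

Definition smooth (phi : V -> R) := forall k, smooth_upto k phi.

(** Identities such as the product rule are available only at points of [D]. Since [D] is open,
    equality there passes to all partial derivatives, so it can replace equality of functions. *)
Definition eq_on (phi psi : V -> R) := forall x, D x -> phi x = psi x.

Lemma eq_on_near (phi psi : V -> R) (x : V) :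
  eq_on phi psi -> D x -> {near x, phi =1 psi}.
Proof.
by move=> e Dx; apply: (filterS e); exact: open_nbhs_nbhs. Qed.

Lemma eq_on_partial (j : 'I_n) (phi psi : V -> R) :
  eq_on phi psi -> eq_on (partial j phi) (partial j psi).
Proof. by move=> e x Dx; apply: near_eq_derive; exact: eq_on_near. Qed.

Lemma eq_on_smooth_upto (k : nat) (phi psi : V -> R) :
  eq_on phi psi -> smooth_upto k phi -> smooth_upto k psi.
Proof.
elim: k phi psi => [|k IH] phi psi e /= [[C bC] S].
  by split=> //; exists C => x D0x; rewrite -e; [exact: bC | exact: subD0].
split; first by exists C => x D0x; rewrite -e; [exact: bC | exact: subD0].
move=> j; have [d s] := S j; split.
  by move=> x Dx; apply: near_eq_derivable (d x Dx); exact: eq_on_near.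
exact: IH (eq_on_partial j _ _ e) s.
Qed.

Lemma smooth_uptoW (k : nat) (phi : V -> R) :
  smooth_upto k.+1 phi -> smooth_upto k phi.
Proof.
elim: k phi => [|k IH] phi [b S]; first by [].
by split=> // j; have [d s] := S j; split=> //; exact: IH.
Qed.

Lemma partialD (j : 'I_n) (phi psi : V -> R) (x : V) :
  derivable phi x (delta_mx 0 j) -> derivable psi x (delta_mx 0 j) ->
  partial j (fun y => phi y + psi y) x = partial j phi x + partial j psi x.
Proof. by move=> d1 d2; exact: (deriveD d1 d2). Qed.

Lemma partialM (j : 'I_n) (phi psi : V -> R) (x : V) :
  derivable phi x (delta_mx 0 j) -> derivable psi x (delta_mx 0 j) ->
  partial j (fun y => phi y * psi y) x =
  phi x * partial j psi x + psi x * partial j phi x.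
Proof. by move=> d1 d2; exact: (deriveM d1 d2). Qed.

Lemma smooth_uptoD (k : nat) (phi psi : V -> R) :
  smooth_upto k phi -> smooth_upto k psi ->
  smooth_upto k (fun x => phi x + psi x).
Proof.
elim: k phi psi => [|k IH] phi psi [[C1 b1] S1] [[C2 b2] S2];
  (split; first by exists (C1 + C2) => x D0x;
     apply: le_trans (ler_normD _ _) _; apply: lerD; [exact: b1 | exact: b2]).
  by [].
move=> j; have [d1 s1] := S1 j; have [d2 s2] := S2 j; split.
  by move=> x Dx; apply: derivableD; [exact: d1 | exact: d2].
apply: eq_on_smooth_upto (IH _ _ s1 s2) => x Dx.
by rewrite partialD//; [exact: d1 | exact: d2].
Qed.

Lemma smooth_uptoM (k : nat) (phi psi : V -> R) :
  smooth_upto k phi -> smooth_upto k psi ->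
  smooth_upto k (fun x => phi x * psi x).
Proof.
elim: k phi psi => [|k IH] phi psi.
  move=> [[C1 b1] _] [[C2 b2] _]; split=> //; exists (C1 * C2) => x D0x.
  by rewrite normrM; apply: ler_pM => //; [exact: b1 | exact: b2].
(* The product rule pairs an undifferentiated factor with a derivative of the other one, so the
   induction hypothesis at level [k] needs the factors themselves at level [k] too. *)
move=> S1 S2; have [S1' S2'] := (smooth_uptoW _ _ S1, smooth_uptoW _ _ S2).
case: S1 => [[C1 b1] S1]; case: S2 => [[C2 b2] S2]; split.
  exists (C1 * C2) => x D0x.
  by rewrite normrM; apply: ler_pM => //; [exact: b1 | exact: b2].
move=> j; have [d1 s1] := S1 j; have [d2 s2] := S2 j; split.
  by move=> x Dx; apply: derivableM; [exact: d1 | exact: d2].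
apply: eq_on_smooth_upto (smooth_uptoD _ _ _ (IH _ _ S1' s2) (IH _ _ S2' s1)).
by move=> x Dx; rewrite partialM//; [exact: d1 | exact: d2].
Qed.

Lemma smooth_cst (a : R) : smooth (fun=> a).
Proof.
move=> k; elim: k a => [|k IH] a /=; (split; first by exists `|a|) => //.
move=> j; split; first by move=> x _; exact: derivable_cst.
by apply: eq_on_smooth_upto (IH 0) => x _; rewrite /partial derive_cst.
Qed.

Lemma eq_on_smooth (phi psi : V -> R) :
  eq_on phi psi -> smooth phi -> smooth psi.
Proof. by move=> e S k; exact: eq_on_smooth_upto e (S k). Qed.

Lemma smoothD (phi psi : V -> R) :
  smooth phi -> smooth psi -> smooth (fun x => phi x + psi x).
Proof. by move=> S1 S2 k; exact: smooth_uptoD. Qed.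

Lemma smoothM (phi psi : V -> R) :
  smooth phi -> smooth psi -> smooth (fun x => phi x * psi x).
Proof. by move=> S1 S2 k; exact: smooth_uptoM. Qed.

Lemma smooth_sum (I : Type) (s : seq I) (phi : I -> V -> R) :
  (forall i, smooth (phi i)) -> smooth (fun x => \sum_(i <- s) phi i x).
Proof.
move=> S; elim: s => [|i s IH].
  by apply: eq_on_smooth (smooth_cst 0) => x _; rewrite big_nil.
by apply: eq_on_smooth (smoothD _ _ (S i) IH) => x _; rewrite big_cons.
Qed.

Lemma smooth_derivable (phi : V -> R) (j : 'I_n) (x : V) :
  smooth phi -> D x -> derivable phi x (delta_mx 0 j).
Proof. by move=> /(_ 1%N)[_ /(_ j)[+ _]]; exact. Qed.

Lemma smooth_partial (phi : V -> R) (j : 'I_n) :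
  smooth phi -> smooth (partial j phi).
Proof. by move=> S k; have [_ /(_ j)[]] := S k.+1. Qed.

Lemma smooth_bounded (phi : V -> R) :
  smooth phi -> exists C, forall x, D0 x -> `|phi x| <= C.
Proof. by move=> /(_ 0%N)[]. Qed.

Lemma smooth_coordinate (j : 'I_n) :
  (exists C, forall x : V, D0 x -> `|x 0 j| <= C) -> smooth (coordinate j).
Proof.
move=> bj [|k]; split=> // i.
have dc (x : V) : derivable (coordinate j) x (delta_mx 0 i : V).
  by have /derivable_mxP := derivable_id (x := x) (v := delta_mx 0 i); apply.
split; first by move=> x _; exact: dc.
apply: eq_on_smooth_upto (smooth_cst ((delta_mx 0 i : V) 0 j) k) => x _.
have := derive_mx (derivable_id (x := x) (v := delta_mx 0 i)).
by rewrite derive_id => /matrixP/(_ 0 j) ->; rewrite mxE.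
Qed.

(** Stability under composition guides this choice: respecting [eq_on] lets an identity valid only
    on [D] be substituted under [B], and linearity then pulls scalar amplitudes out of [B]. *)
Record smooth_operator (B : (V -> R) -> V -> R) : Prop := SmoothOperator {
  smooth_operator_smooth : forall phi, smooth phi -> smooth (B phi);
  smooth_operator_eq : forall phi psi, eq_on phi psi -> eq_on (B phi) (B psi);
  smooth_operator_linear : forall a phi psi, smooth phi -> smooth psi ->
    eq_on (B (fun x => a * phi x + psi x)) (fun x => a * B phi x + B psi x) }.

Lemma smooth_operator_id : smooth_operator id.
Proof. by []. Qed.

Lemma smooth_operator_comp (A B : (V -> R) -> V -> R) :
  smooth_operator A -> smooth_operator B ->
  smooth_operator (fun phi => A (B phi)).
Proof.
move=> [sA eA lA] [sB eB lB]; split.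
- by move=> phi /sB /sA.
- by move=> phi psi /eB /eA.
- move=> a phi psi Sphi Spsi x Dx.
  by rewrite -lA//; [apply: eA => //; exact: lB | exact: sB | exact: sB].
Qed.

Lemma smooth_operator_sum (B : (V -> R) -> V -> R) (I : Type) (s : seq I)
    (a : I -> R) (phi : I -> V -> R) :
  smooth_operator B -> (forall i, smooth (phi i)) ->
  eq_on (B (fun x => \sum_(i <- s) a i * phi i x))
        (fun x => \sum_(i <- s) a i * B (phi i) x).
Proof.
move=> [sB eB lB] S; elim: s => [|i s IH] x Dx.
  (* That [B] kills the zero function comes from linearity with scalar -1: B(0) = -B(0) + B(0). *)
  rewrite big_nil (eB _ (fun y => -1 * 0 + 0)) //.
    have := lB (-1) (fun=> 0) (fun=> 0) (smooth_cst 0) (smooth_cst 0) x Dx.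
    by move=> ->; rewrite mulN1r addNr.
  by move=> y _; rewrite big_nil mulr0 addr0.
rewrite big_cons -IH// -lB//; last first.
  by apply: smooth_sum => l; apply: smoothM => //; exact: smooth_cst.
by apply: eB => // y _; rewrite big_cons.
Qed.

Lemma smooth_operator_vf_act (X : V -> V) :
  (forall j, smooth (coordinate j \o X)) -> smooth_operator (vf_act X).
Proof.
move=> SX; split.
- move=> phi S; apply: smooth_sum => j.
  by apply: smoothM; [exact: SX | exact: smooth_partial].
- move=> phi psi e x Dx; apply: eq_bigr => j _.
  by rewrite (eq_on_partial j _ _ e).
- move=> a phi psi S1 S2 x Dx; rewrite /vf_act mulr_sumr -big_split/=.
  apply: eq_bigr => j _; rewrite partialD; last 2 first.
  + by apply: smooth_derivable => //; apply: smoothM => //; exact: smooth_cst.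
  + exact: smooth_derivable.
  rewrite partialM; last 2 first.
  + exact: derivable_cst.
  + exact: smooth_derivable.
  by rewrite /partial derive_cst mulr0 addr0 mulrDr mulrCA.
Qed.

End SmoothFunctions.

(** * Norms of row vectors and integrals of continuous functions over segments *)

Lemma row_norm_le (R : realType) (n : nat) (y : 'rV[R]_n) (C : R) :
  0 <= C -> (forall j, `|y 0 j| <= C) -> `|y| <= C.
Proof.
move=> C0 yC; rewrite [leLHS]/Num.norm/= mx_normrE.
by apply/bigmax_leP; split=> // -[i j] _ /=; rewrite ord1.
Qed.

Lemma within_continuousM (R : realType) (A : set R) (f g : R -> R) :
  {within A, continuous f} -> {within A, continuous g} ->
  {within A, continuous (fun x => f x * g x)}.
Proof.
move=> cf cg.
have H (x : subspace A) := @continuousM R (subspace A) f g x (cf x) (cg x).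
exact: H.
Qed.

Lemma continuous_itv_integrable (R : realType) (f : R -> R) (a c : R) :
  {within `[a, c], continuous f} ->
  lebesgue_measure.-integrable `[a, c] (EFin \o f).
Proof.
move=> cf; apply: continuous_compact_integrable => //; exact: segment_compact.
Qed.

Lemma Rintegral_sum_continuous (R : realType) (I : Type) (s : seq I)
    (f : I -> R -> R) (a c : R) :
  (forall i, {within `[a, c], continuous (f i)}) ->
  \int[lebesgue_measure]_(x in `[a, c]) (\sum_(i <- s) f i x) =
  \sum_(i <- s) \int[lebesgue_measure]_(x in `[a, c]) f i x.
Proof.
move=> cf; elim: s => [|i s IH].
  under eq_Rintegral do rewrite big_nil.
  by rewrite big_nil Rintegral_cst// mul0r.
rewrite big_cons -IH -RintegralD//; last 2 first.
- exact: continuous_itv_integrable.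
- rewrite (_ : _ \o _ = fun x => (\sum_(i <- s) (f i x)%:E)%E).
    by apply: integrable_sum => // j _; exact: continuous_itv_integrable.
  by apply/funext => x /=; rewrite sumEFin.
by apply: eq_Rintegral => x _; rewrite big_cons.
Qed.

(** * Expansions in the amplitudes of the inputs, with bounds uniform in the amplitudes *)

Section ChronologicalExpansion.
Context {R : realType} {n m : nat} (D D0 : set 'rV[R]_n).
Hypotheses (openD : open D) (subD0 : D0 `<=` D).
Local Notation V := 'rV[R]_n.
Local Notation operator := ((V -> R) -> V -> R).
Local Notation smooth := (smooth D D0).
Local Notation smooth_operator := (smooth_operator D D0).
Local Notation eq_on := (eq_on D).

(** The size estimate satisfied by a monomial of degree [d]. The number [e] will be [epsilon], and
    [C] depends neither on it nor on [alpha]. *)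
Definition bounded_degree (d : nat) (a : ('I_m -> R) -> R) : Prop :=
  exists C, forall e alpha, 0 <= e -> (forall i, `|alpha i| <= e) ->
    `|a alpha| <= C * e ^+ d.

Lemma bounded_degreeM (d1 d2 : nat) (a1 a2 : ('I_m -> R) -> R) :
  bounded_degree d1 a1 -> bounded_degree d2 a2 ->
  bounded_degree (d1 + d2) (fun alpha => a1 alpha * a2 alpha).
Proof.
move=> [C1 b1] [C2 b2]; exists (C1 * C2) => e alpha e0 ale.
by rewrite normrM exprD mulrACA; apply: ler_pM => //; [exact: b1 | exact: b2].
Qed.

Lemma bounded_degree_cst (c : R) : bounded_degree 0 (fun=> c).
Proof. by exists `|c| => e alpha _ _; rewrite expr0 mulr1. Qed.

Lemma bounded_degree_amplitude (i : 'I_m) :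
  bounded_degree 1 (fun alpha => alpha i).
Proof. by exists 1 => e alpha _; rewrite expr1 mul1r; exact. Qed.

(* A is a family of operators parametrized by the amplitudes alpha of the inputs;
   the B j do not depend on alpha, so only finitely many functions have to be
   bounded, uniformly in alpha. *)
Definition expansion (d : nat) (A : ('I_m -> R) -> operator) : Prop :=
  exists (J : finType) (a : J -> ('I_m -> R) -> R) (B : J -> operator),
    [/\ forall j, bounded_degree d (a j), forall j, smooth_operator (B j)
      & forall alpha phi, smooth phi ->
          eq_on (A alpha phi) (fun x => \sum_j a j alpha * B j phi x)].

Lemma expansion0 (d : nat) : expansion d (fun _ _ _ => 0).
Proof.
exists void, (fun _ _ => 0), (fun _ => id); split=> [[]|[]|alpha phi _ x _].
by rewrite big1// => -[].
Qed.

Lemma expansion_id : expansion 0 (fun _ phi => phi).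
Proof.
exists unit, (fun _ _ => 1), (fun _ => id); split => [_|_|alpha phi _ x _].
- exact: bounded_degree_cst.
- exact: smooth_operator_id.
- by rewrite (big_pred1 tt) ?mul1r// => -[].
Qed.

Lemma expansionD (d : nat) (A1 A2 : ('I_m -> R) -> operator) :
  expansion d A1 -> expansion d A2 ->
  expansion d (fun alpha phi x => A1 alpha phi x + A2 alpha phi x).
Proof.
move=> [J1 [a1 [B1 [h1 s1 e1]]]] [J2 [a2 [B2 [h2 s2 e2]]]].
exists (J1 + J2)%type, (fun j => match j with inl j => a1 j | inr j => a2 j end),
  (fun j => match j with inl j => B1 j | inr j => B2 j end); split.
- by case.
- by case.
- by move=> alpha phi S x Dx; rewrite big_sumType e1// e2.
Qed.

Lemma expansionZ (d : nat) (c : R) (A : ('I_m -> R) -> operator) :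
  expansion d A -> expansion d (fun alpha phi x => c * A alpha phi x).
Proof.
move=> [J [a [B [h s e]]]]; exists J, (fun j alpha => c * a j alpha), B; split=> //.
- by move=> j; exact: (bounded_degreeM _ _ _ _ (bounded_degree_cst c) (h j)).
- move=> alpha phi S x Dx; rewrite e// mulr_sumr.
  by apply: eq_bigr => j _; rewrite mulrA.
Qed.

Lemma expansion_sum (d : nat) (I : eqType) (r : seq I)
    (A : I -> ('I_m -> R) -> operator) :
  (forall i, i \in r -> expansion d (A i)) ->
  expansion d (fun alpha phi x => \sum_(i <- r) A i alpha phi x).
Proof.
elim: r => [_|i r IH hA].
  have [J [a [B [h s e]]]] := expansion0 d; exists J, a, B; split=> //.
  by move=> alpha phi S x Dx; rewrite big_nil; exact: (e alpha phi S x Dx).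
have /IH hr : forall j, j \in r -> expansion d (A j).
  by move=> j jr; apply: hA; rewrite inE jr orbT.
have [J [a [B [h s e]]]] := expansionD _ _ _ (hA i (mem_head _ _)) hr.
exists J, a, B; split=> //.
by move=> alpha phi S x Dx; rewrite big_cons; exact: (e alpha phi S x Dx).
Qed.

Lemma expansion_smooth (d : nat) (A : ('I_m -> R) -> operator)
    (alpha : 'I_m -> R) (phi : V -> R) :
  expansion d A -> smooth phi -> smooth (A alpha phi).
Proof.
move=> [J [a [B [_ s e]]]] S.
apply: (@eq_on_smooth _ _ _ _ openD subD0 (fun x => \sum_j a j alpha * B j phi x)).
  by move=> x Dx; rewrite e.
apply: smooth_sum => // j; apply: smoothM => //; first exact: smooth_cst.
exact: smooth_operator_smooth.
Qed.

(** Degrees add because the coefficients multiply: the inner expansion is substituted under each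
    outer [B1 j1], and its coefficients, constant in [x], come out by linearity. *)
Lemma expansion_comp (d1 d2 : nat) (A1 A2 : ('I_m -> R) -> operator) :
  expansion d1 A1 -> expansion d2 A2 ->
  expansion (d1 + d2) (fun alpha phi => A1 alpha (A2 alpha phi)).
Proof.
move=> [J1 [a1 [B1 [h1 s1 e1]]]] E2; have [J2 [a2 [B2 [h2 s2 e2]]]] := E2.
exists (J1 * J2)%type, (fun j alpha => a1 j.1 alpha * a2 j.2 alpha),
  (fun j phi => B1 j.1 (B2 j.2 phi)); split.
- by move=> j; exact: bounded_degreeM.
- by move=> j; exact: smooth_operator_comp.
move=> alpha phi S x Dx; rewrite e1//; last exact: expansion_smooth E2 S.
rewrite -(pair_bigA _ (fun j1 j2 => a1 j1 alpha * a2 j2 alpha * B1 j1 (B2 j2 phi) x))/=.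
apply: eq_bigr => j1 _.
rewrite (smooth_operator_eq _ _ _ (s1 j1) _ _ (e2 alpha phi S))//.
rewrite (smooth_operator_sum _ _ openD subD0)//; last first.
  by move=> j2; exact: (smooth_operator_smooth _ _ _ (s2 j2)).
by rewrite mulr_sumr; apply: eq_bigr => j2 _; rewrite mulrA.
Qed.

(** The finitely many functions [B j phi] are each bounded on [D0], independently of [alpha]; all
    dependence on [alpha] is in the coefficients. *)
Lemma expansion_bound (d : nat) (A : ('I_m -> R) -> operator) (phi : V -> R) :
  expansion d A -> smooth phi ->
  exists K, forall e alpha, 0 <= e -> (forall i, `|alpha i| <= e) ->
    forall x, D0 x -> `|A alpha phi x| <= K * e ^+ d.
Proof.
move=> [J [a [B [h s E]]]] S.
have /choice[C hC] := h.
have /choice[K hK] : forall j, exists K, forall x, D0 x -> `|B j phi x| <= K.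
  by move=> j; exact/smooth_bounded/(smooth_operator_smooth _ _ _ (s j)).
exists (\sum_j C j * K j) => e alpha e0 ale x D0x.
rewrite E//; last exact: subD0.
rewrite mulr_suml; apply: le_trans (ler_norm_sum _ _ _) _; apply: ler_sum => j _.
rewrite normrM mulrAC; apply: ler_pM => //; [exact: hC | exact: hK].
Qed.

(** * The chronological series and its logarithm for a field linear in the inputs *)

Variables (v : 'I_m -> R -> R) (c : 'I_m -> V -> V).
Hypothesis continuous_v :
  forall i T, {within `[0, T], continuous (v i)}.
Hypothesis smooth_c : forall i j, smooth (coordinate j \o c i).

(** The amplitude [alpha i] will be the product of [epsilon] and eta_i, so that the dependence on w
    is confined to [alpha]. *)
Definition controlled_field (alpha : 'I_m -> R) (tau : R) (x : V) : V :=
  \sum_(i < m) (alpha i * v i tau) *: c i x.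

Lemma vf_act_controlled_field (alpha : 'I_m -> R) (tau : R) (phi : V -> R) :
  vf_act (controlled_field alpha tau) phi =
  fun x => \sum_(i < m) alpha i * v i tau * vf_act (c i) phi x.
Proof.
apply/funext => x; rewrite /vf_act; under [RHS]eq_bigr do rewrite mulr_sumr.
rewrite exchange_big/=; apply: eq_bigr => j _.
rewrite /controlled_field summxE mulr_suml; apply: eq_bigr => i _.
by rewrite mxE mulrA.
Qed.

(** Time stays variable because the recursion integrates over it again: the factors [g j] carry it
    and remain continuous. Each level adds one input index i, one factor [alpha i], one integration
    against [v i], and the derivation along [c i], which acts first on [phi]. *)
Lemma chrono_expansion_time (q : nat) :
  exists (J : finType) (a : J -> ('I_m -> R) -> R) (g : J -> R -> R)
    (B : J -> operator),
    [/\ forall j, bounded_degree q (a j),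
        forall j T, {within `[0, T], continuous (g j)},
        forall j, smooth_operator (B j)
      & forall alpha tau phi, smooth phi ->
          eq_on (chrono (controlled_field alpha) q tau phi)
            (fun x => \sum_j a j alpha * g j tau * B j phi x)].
Proof.
elim: q => [|q [J [a [g [B [ha hg hB E]]]]]].
  exists unit, (fun _ _ => 1), (fun _ _ => 1), (fun _ => id).
  split=> [_|_ T x|_|alpha tau phi _ x _].
  - exact: bounded_degree_cst.
  - exact: cvg_cst.
  - exact: smooth_operator_id.
  - by rewrite (big_pred1 tt) ?mul1r// => -[].
have gv j T : {within `[0, T], continuous (fun s => g j.1 s * v j.2 s)}.
  by apply: within_continuousM; [exact: hg | exact: continuous_v].
exists (J * 'I_m)%type, (fun j alpha => a j.1 alpha * alpha j.2),
  (fun j tau => \int[lebesgue_measure]_(s in `[0, tau]) (g j.1 s * v j.2 s)),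
  (fun j phi => B j.1 (vf_act (c j.2) phi)); split.
- move=> j; rewrite -addn1; apply: bounded_degreeM => //.
  exact: bounded_degree_amplitude.
- move=> j T; have [T0|T0] := leP 0 T; last first.
    by rewrite set_itv_ge ?bnd_simp -?ltNge//; exact: continuous_subspace0.
  exact/(parameterized_integral_continuous T0)/continuous_itv_integrable.
- move=> j; apply: smooth_operator_comp => //; exact: smooth_operator_vf_act.
move=> alpha tau phi S x Dx /=.
have Sc i : smooth (vf_act (c i) phi).
  by apply: smooth_operator_smooth S; exact: smooth_operator_vf_act.
(* In this form of the integrand only the last factor of each summand depends on [s]. *)
transitivity (\int[lebesgue_measure]_(s in `[0, tau])
   \sum_(j : J * 'I_m) a j.1 alpha * alpha j.2 * B j.1 (vf_act (c j.2) phi) x *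
      (g j.1 s * v j.2 s)).
  apply: eq_Rintegral => s _; rewrite vf_act_controlled_field E//; last first.
    by apply: smooth_sum => // i; apply: smoothM => //; exact: smooth_cst.
  rewrite -(pair_bigA _ (fun j i => a j alpha * alpha i *
    B j (vf_act (c i) phi) x * (g j s * v i s)))/=.
  apply: eq_bigr => j _; rewrite (smooth_operator_sum _ _ openD subD0)//.
  by rewrite mulr_sumr; apply: eq_bigr => i _; ring.
rewrite Rintegral_sum_continuous; last first.
  by move=> j; apply: within_continuousM; [exact: cst_continuous | exact: gv].
apply: eq_bigr => j _; rewrite RintegralZl//; first by ring.
exact: continuous_itv_integrable.
Qed.

Variable (T : R).

Lemma chrono_expansion (q : nat) :
  expansion q (fun alpha => chrono (controlled_field alpha) q T).
Proof.
have [J [a [g [B [ha hg hB E]]]]] := chrono_expansion_time q.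
exists J, (fun j alpha => g j T * a j alpha), B; split=> //.
- by move=> j; exact: (bounded_degreeM _ _ _ _ (bounded_degree_cst (g j T)) (ha j)).
- move=> alpha phi S x Dx; rewrite E//.
  by apply: eq_bigr => j _; rewrite (mulrC (g j T)).
Qed.

Lemma chrono_pow_expansion (k d : nat) :
  expansion d (fun alpha => chrono_pow (controlled_field alpha) T k d).
Proof.
elim: k d => [|k IH] d /=.
  by case: d => [|d]; [exact: expansion_id | exact: expansion0].
apply: expansion_sum => q; rewrite mem_index_iota ltnS => /andP[_ qd].
(* The degrees [q] and [d - q] add up to [d] because [q] is at most [d] in the sum, so the truncated
   subtraction is exact. *)
by have := expansion_comp _ _ _ _ (chrono_expansion q) (IH (d - q)%N); rewrite subnKC.
Qed.

Lemma chrono_log_expansion (d : nat) :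
  expansion d (fun alpha => chrono_log (controlled_field alpha) T d).
Proof.
by apply: expansion_sum => k _; apply: expansionZ; exact: chrono_pow_expansion.
Qed.

Lemma log_vf_bound (d : nat) :
  (forall j : 'I_n, smooth (coordinate j)) ->
  exists K, forall e alpha, 0 <= e -> (forall i, `|alpha i| <= e) ->
    forall x, D0 x -> `|log_vf (controlled_field alpha) T d x| <= K * e ^+ d.
Proof.
move=> Sx.
have /choice[K hK] := fun j =>
  expansion_bound _ _ _ (chrono_log_expansion d) (Sx j).
(* One constant for all coordinates; the absolute values are there because the [K j] carry no sign
   information. *)
exists (\sum_j `|K j|) => e alpha e0 ale x D0x.
have K0 : 0 <= (\sum_j `|K j|) * e ^+ d by rewrite mulr_ge0 ?exprn_ge0 ?sumr_ge0.
apply: row_norm_le => // j; rewrite mxE; apply: le_trans (hK j _ _ e0 ale _ D0x) _.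
rewrite ler_wpM2r ?exprn_ge0// (bigD1 j)//=.
by apply: le_trans (ler_norm _) _; rewrite lerDl sumr_ge0.
Qed.

End ChronologicalExpansion.

(** * From the assumptions on fields and inputs to the hypotheses of the expansion *)

Lemma compact_row_coordinate_bounded (R : realType) (n : nat)
    (K : set 'rV[R]_n) (j : 'I_n) :
  compact K -> exists C, forall x, K x -> `|x 0 j| <= C.
Proof.
move=> cK.
have cjK : compact ((fun x : 'rV[R]_n => x 0 j) @` K).
  apply: continuous_compact => //; apply: continuous_subspaceT => x.
  exact: coord_continuous.
have [C _ bC] := pinfty_ex_gt0 (compact_bounded cjK).
by exists C => x Kx; apply: bC; exists x.
Qed.

Lemma assumption_A1_smooth (R : realType) (n m : nat) (D D0 : set 'rV[R]_n)
    (b : 'I_m.+1 -> 'rV[R]_n -> 'rV[R]_n) (i : 'I_m.+1) (l : 'I_n) :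
  compact D0 -> D0 `<=` D -> assumption_A1 D b ->
  smooth D D0 (coordinate l \o b i).
Proof.
move=> cD0 subD0 A1 k.
(* The induction on the order runs over all iterated partial derivatives at once, since
   differentiating one of them only lengthens [s]. *)
suff : forall s, smooth_upto D D0 k (partials s (coordinate l \o b i)).
  exact: (fun H => H [::]).
elim: k => [|k IH] s; (split; first by have [_ _ bs] := A1 _ cD0 subD0 i l s;
  have [C _ bC] := pinfty_ex_gt0 bs; exists C) => //.
move=> j; split; last exact: (IH (j :: s)).
(* Bounds come from the compact set [D0], but derivability is wanted on all of [D], so the
   assumption is applied to the compact set {x}. *)
move=> x Dx; have xD : [set x] `<=` D by move=> y ->.
by have [+ _ _] := A1 _ (@compact_set1 _ x) xD i l s; apply.
Qed.

Lemma assumption_A2_continuous (R : realType) (m : nat) (k : 'I_m -> rat)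
    (u : 'I_m -> R -> R) (i : 'I_m) (T : R) :
  assumption_A2 k u ->
  {within `[0, T], continuous (fun tau => u i (ratr (k i) * tau))}.
Proof.
(* At w = 1 the times t and tau coincide, and the Lipschitz bound gives continuity. *)
move=> /(_ 1 ltr01 i)[_ [N N0 lipN] _ _ _].
apply/subspace_continuousP => x; rewrite /= in_itv/= => /andP[x0 _].
apply/cvgrPdist_le => e e0.
have near_x : \forall t \near x, `|x - t| <= N^-1 * e.
  have /cvgrPdist_le : y @[y --> x] --> x by exact: cvg_id.
  by apply; rewrite mulr_gt0 ?invr_gt0.
near=> t; have t0 : 0 <= t.
  have : `[0, T]%classic t by near: t; exact: withinT.
  by rewrite /= in_itv/= => /andP[].
have := lipN x t x0 t0; rewrite !mulr1 => /le_trans; apply.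
by rewrite -ler_pdivlMl//; near: t; exact: cvg_within near_x.
Unshelve. all: by end_near. Qed.

(** The period in the scale tau is thus the same for all w, so one integration interval, and one
    constant, serves every w. *)
Lemma mul_period (R : realType) (m : nat) (k : 'I_m -> rat) (w : R) :
  0 < w -> w * period k w = period k 1.
Proof.
by move=> w0; rewrite /period divr1 mulrA (mulrCA w) divff ?mulr1// gt_eqF.
Qed.

(** * Powers of w and the size of the averaging terms *)

Lemma powR_le1_ge1 (R : realType) (w a : R) : 1 <= w -> a <= 0 -> w `^ a <= 1.
Proof. by move=> w1 a0; rewrite -(powRr0 w); exact: ler_powR. Qed.

Lemma cvg_powRN (R : realType) (s : R) :
  s < 0 -> w `^ s @[w --> +oo] --> (0 : R).
Proof.
move=> s0; apply/cvgrPdist_le => e e0.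
(* The threshold solves w^s = e; beyond it the inverses are compared, where the exponent -s is
   positive and the power increasing. *)
have M0 : 0 < e `^ s^-1 by exact: powR_gt0.
near=> w; have wM : e `^ s^-1 <= w by near: w; exact: nbhs_pinfty_ge.
have w0 : 0 < w := lt_le_trans M0 wM.
rewrite sub0r normrN ger0_norm ?powR_ge0//.
rewrite -[s]opprK powRN -[leRHS]invrK lef_pV2 ?posrE ?invr_gt0 ?powR_gt0//.
rewrite -(powRr1 (ltW e0)) -powRN (_ : -1 = s^-1 * - s); last first.
  by rewrite mulrN mulVf// lt_eqF.
by rewrite powRrM ge0_ler_powR ?nnegrE ?oppr_ge0 ?powR_ge0 ?ltW.
Unshelve. all: by end_near. Qed.

Lemma averaging_term_bound (R : realType) (n m : nat) (D D0 : set 'rV[R]_n)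
    (b : 'I_m.+1 -> 'rV[R]_n -> 'rV[R]_n) (u : 'I_m -> R -> R)
    (k : 'I_m -> rat) (p : 'I_m -> R) (pstar : R) (d : nat) :
  open D -> compact D0 -> D0 `<=` D -> assumption_A1 D b -> assumption_A2 k u ->
  (forall i, p i <= pstar) ->
  exists C, 0 <= C /\ forall w z, 1 <= w -> D0 z ->
    `|L b u k p pstar d w z| <= C * (epsilon pstar w ^+ d * w).
Proof.
move=> openD cD0 subD0 A1 A2 ple.
have [K hK] := log_vf_bound _ _ openD subD0 _ (fun i => b (lift ord0 i))
  (fun i T => assumption_A2_continuous _ _ _ _ i T A2)
  (fun i j => assumption_A1_smooth _ _ _ _ _ _ (lift ord0 i) j cD0 subD0 A1)
  (period k 1) d
  (fun j => smooth_coordinate _ _ openD subD0 j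
     (compact_row_coordinate_bounded _ _ _ j cD0)).
exists (`|(period k 1)^-1| * `|K|); split=> [|w z w1 D0z]; first by rewrite mulr_ge0.
have w0 : 0 < w := lt_le_trans ltr01 w1.
rewrite /L /Lambda mul_period// !normrZ (ger0_norm (ltW w0)).
set X := (X in log_vf X).
have -> : X = controlled_field (fun i tau => u i (ratr (k i) * tau))
    (fun i => b (lift ord0 i))
    (fun i => epsilon pstar w * eta_coef p pstar w i).
  apply/funext => tau; apply/funext => x.
  rewrite /X /f_field /controlled_field scaler_sumr.
  by apply: eq_bigr => i _; rewrite scalerA mulrA.
rewrite [leLHS]mulrC [leRHS]mulrA ler_wpM2r ?(ltW w0)//.
rewrite -[leRHS]mulrA ler_wpM2l//.
have e0 : 0 <= epsilon pstar w := powR_ge0 _ _.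
apply: le_trans (hK (epsilon pstar w) _ e0 _ z D0z) _; last first.
  by rewrite ler_wpM2r ?exprn_ge0 ?ler_norm.
move=> i; rewrite normrM ger0_norm// ger0_norm ?powR_ge0//.
by rewrite ler_piMr// powR_le1_ge1// subr_le0.
Qed.

(** * The vanishing remainder and the limit of the complete averaged system *)

Theorem proposition5 (R : realType) (n m : nat)
    (D D0 : set 'rV[R]_n) (b : 'I_m.+1 -> 'rV[R]_n -> 'rV[R]_n)
    (u : 'I_m -> R -> R) (k : 'I_m -> rat) (p : 'I_m -> R)
    (pstar : R) (r : nat) (G : 'rV[R]_n -> 'rV[R]_n)
    (openD : open D) (compactD0 : compact D0) (subD0 : D0 `<=` D)
    (k_gt0 : forall i, 0 < k i)
    (A1 : assumption_A1 D b) (A2 : assumption_A2 k u)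
    (p01 : forall i, 0 < p i < 1)
    (r_ge1 : (1 <= r)%N)
    (limG : forall z, D0 z ->
      averaged_rhs b u k p pstar r w z @[w --> +oo] --> G z)
    (maxp_gt0 : 0 < \big[Num.max/0]_(i < m) p i)
    (maxp_le : \big[Num.max/0]_(i < m) p i <= pstar)
    (pstar_lt : pstar < r%:R / r.+1%:R) :
  (* the higher averaging terms contribute O(epsilon^(r+1) w) *)
  (forall N : nat, (r <= N)%N ->
     complete_averaging_rhs D0 b u k p pstar r (averaged_rhs b u k p pstar N))
  /\
  (* every complete averaged right-hand side has a vanishing remainder and
     tends to G *)
  (forall F : R -> 'rV[R]_n -> 'rV[R]_n,
     complete_averaging_rhs D0 b u k p pstar r F ->
     {uniform D0, (fun w z => F w z - averaged_rhs b u k p pstar r w z) @ +oo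
                  --> (fun=> 0 : 'rV[R]_n)}
     /\ (forall z, D0 z -> F w z @[w --> +oo] --> G z)).
Proof.
have ple i : p i <= pstar by apply: le_trans (le_bigmax _ _ i) maxp_le.
have r1 : (0 : R) < r.+1%:R by rewrite ltr0n.
have exp_lt0 : (pstar - 1) * r.+1%:R + 1 < 0.
  move: pstar_lt; rewrite ltr_pdivlMr// => h.
  have : (r.+1%:R : R) = r%:R + 1 by rewrite -natr1.
  by move: h; lra.
have pstar_lt1 : pstar - 1 < 0.
  by rewrite -(pmulr_llt0 _ r1) (lt_trans _ exp_lt0)// ltrDl.
have eps_powR w : 0 < w ->
    epsilon pstar w ^+ r.+1 * w = w `^ ((pstar - 1) * r.+1%:R + 1).
  move=> w0; rewrite powRD; last by rewrite (gt_eqF w0) implybT.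
  by rewrite powRr1 ?(ltW w0)// powRrM powR_mulrn ?powR_ge0.
split.
  move=> N rN.
  have /choice[C hC] := fun d =>
    averaging_term_bound _ _ _ _ _ b u k p pstar d openD compactD0 subD0 A1 A2 ple.
  exists (\sum_(r.+1 <= d < N.+1) C d); near=> w => z D0z.
  have w1 : 1 <= w by near: w; exact: nbhs_pinfty_ge.
  have w0 : 0 < w := lt_le_trans ltr01 w1.
  (* The terms up to degree [r] cancel, leaving degrees r+1 to N. *)
  rewrite /averaged_rhs (big_cat_nat (n := r.+1))//= [X in X - _]addrC addrK.
  apply: le_trans (ler_norm_sum _ _ _) _.
  rewrite mulr_suml big_nat_cond [leRHS]big_nat_cond.
  apply: ler_sum => d /andP[/andP[rd _] _].
  have [C0 /(_ w z w1 D0z)/le_trans] := hC d; apply.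
  rewrite ger0_norm; last by rewrite mulr_ge0 ?exprn_ge0 ?powR_ge0 ?ltW.
  rewrite ler_wpM2l// ler_wpM2r ?(ltW w0)//.
  (* As p* < 1 and w >= 1, [epsilon] is at most 1, so its powers above r+1 are dominated by the
     power r+1. *)
  by apply: ler_wiXn2l => //; [exact: powR_ge0 | exact/powR_le1_ge1/ltW].
move=> F [C hC].
(* Smallness of the remainder with a threshold on w common to all z in [D0]; both conclusions follow
   from it. *)
have rem0 e : 0 < e -> \forall w \near +oo, forall z, D0 z ->
    `|F w z - averaged_rhs b u k p pstar r w z| <= e.
  (* The constant [C] may be zero or negative, so it is enlarged to a positive number by which one
     can divide. *)
  move=> e0; have C0 : 0 < `|C| + 1 by rewrite ltr_wpDl.
  have /cvgrPdist_le/(_ (e / (`|C| + 1)) (divr_gt0 e0 C0)) := cvg_powRN _ _ exp_lt0.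
  move=> small; near=> w => z D0z.
  have w0 : 0 < w by near: w; exact: nbhs_pinfty_gt.
  apply: le_trans (_ : C * `|epsilon pstar w ^+ r.+1 * w| <= _).
    by move: z D0z; near: w; exact: hC.
  apply: le_trans (_ : (`|C| + 1) * `|epsilon pstar w ^+ r.+1 * w| <= _).
    by rewrite ler_wpM2r// (le_trans (ler_norm C))// lerDl.
  rewrite eps_powR// mulrC -ler_pdivlMr// -normrN -sub0r.
  by near: w; exact: small.
split.
  move=> P /uniform_nbhs[E [entE subP]].
  have [e /= e0 ballE] : exists2 e : R, 0 < e &
      forall x : 'rV[R]_n, `|x| < e -> E (0, x).
    move: entE; rewrite -entourage_ballE => -[e e0 sube].
    exists e => // x xe; apply: sube; rewrite /= -ball_normE/= sub0r normrN //.
  (* Halving turns the non-strict bound of [rem0] into the strict one that the entourage asks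
     for. *)
  have e20 : 0 < e / 2 by rewrite divr_gt0.
  apply: filterS (rem0 _ e20) => w hw; apply: subP => z D0z; apply: ballE.
  by apply: le_lt_trans (hw z D0z) _; rewrite ltr_pdivrMr// ltr_pMr// ltr1n.
move=> z D0z.
rewrite (_ : F ^~ z = fun w => (F w z - averaged_rhs b u k p pstar r w z) +
    averaged_rhs b u k p pstar r w z); last by apply/funext => w; rewrite subrK.
rewrite -[G z]add0r; apply: cvgD; last exact: limG.
apply/cvgrPdist_le => e e0; apply: filterS (rem0 _ e0) => w /(_ z D0z).
by rewrite sub0r normrN.
Unshelve. all: by end_near. Qed.
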